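(* Let $p:E_H\to X$ and $q:E_G\to Y$ be rigid fibrations of $X$ and $Y$, respectively, such that $p_*\pi_1(E_H)=H\le \pi_1(X)$ and $q_*\pi_1(E_G)=G\le\pi_1(Y)$. (i) If $g:X\to Y$ is a continuous map such that $g_*(H)\le G$, then there is a map $f:E_H\to E_G$ such that $q\circ f=g\circ p$. (ii) If $g:X\to Y$ is a rigid fibration such that $g_*(H)\le G$, then the map $f:E_H\to E_G$ of part (i), satisfying $q\circ f=g\circ p$, is a rigid fibration. (iii) If $g:X\to Y$ is a continuous map and there is a map $f:E_H\to E_G$ such that $q\circ f=g\circ p$, then $g_*(H)\le G$.
   Context: A fibration is a map with the homotopy lifting property with respect to all spaces (Hurewicz fibration). A fibration $p:E\to X$ is called a rigid fibration (of $X$) if each fiber of $p$ has no nonconstant paths (equivalently, $p$ has unique path lifting). ''Map'' means continuous map. Base points are suppressed: all spaces are pointed, all maps preserve base points, and fundamental groups are taken at the base points.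
   Formalization: In part (i), E_H is additionally assumed path connected and locally path connected; without these (i) is false, e.g. X = Y = S^1, g = id, E_H a path component of the dyadic solenoid, E_G = R. Parts (ii) and (iii) carry no added assumption; (ii) holds for every f with q∘f = g∘p. *)

(* Defs.v *)
From HB Require Import structures.
From mathcomp Require Import all_boot all_order all_algebra.
From mathcomp Require Import generic_quotient.
From mathcomp Require Import ring lra.
From mathcomp Require Import all_classical all_reals all_analysis.
From mathcomp Require Import homotopy.

Set Implicit Arguments.
Unset Strict Implicit.
Unset Printing Implicit Defensive.

Import Order.TTheory GRing.Theory Num.Theory.
Import numFieldNormedType.Exports.

Local Open Scope classical_set_scope.
Local Open Scope ring_scope.
Local Open Scope quotient_scope.

(* The unit interval, with the topology of a subtype of R. *)
Definition unitI (R : realType) : Type := set_type (`[0, 1]%classic : set R).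

HB.instance Definition _ (R : realType) :=
  Topological.copy (unitI R) (set_type (`[0, 1]%classic : set R)).

Section unit_interval.
Context {R : realType}.
Local Notation I := (unitI R).

Definition ival (s : I) : R := set_val s.

Lemma ival_ge0 (s : I) : 0 <= ival s.
Proof. by have /set_mem/= := svalP s; rewrite in_itv/= => /andP[]. Qed.

Lemma ival_le1 (s : I) : ival s <= 1.
Proof. by have /set_mem/= := svalP s; rewrite in_itv/= => /andP[]. Qed.

Lemma ival_inj : injective ival.
Proof. by move=> s t; exact: val_inj. Qed.

Lemma ival_continuous : continuous ival.
Proof. exact: initial_continuous. Qed.

Lemma clamp_subproof (x : R) :
  Num.max 0 (Num.min 1 x) \in (`[0, 1]%classic : set R).
Proof.
apply/mem_set; rewrite /= in_itv/= le_max lexx/= ge_max ler01/=.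
by rewrite ge_min lexx.
Qed.

Definition clamp (x : R) : I := SigSub (clamp_subproof x).

Lemma clampE (x : R) : 0 <= x <= 1 -> ival (clamp x) = x.
Proof.
move=> /andP[x0 x1].
by rewrite /ival set_valE/= (min_r x1) max_r.
Qed.

Lemma ivalK : cancel ival clamp.
Proof. by move=> s; apply/ival_inj/clampE; rewrite ival_ge0 ival_le1. Qed.

Lemma clamp_continuous : continuous clamp.
Proof.
apply: continuous_comp_initial => x.
apply: continuous_max; first exact: cvg_cst.
by apply: continuous_min; [exact: cvg_cst|exact: cvg_id].
Qed.

Lemma clamp01_neq : clamp 0 != clamp 1.
Proof.
apply/eqP => /(congr1 ival); rewrite !clampE ?lexx ?ler01//.
by move=> /eqP; rewrite eq_sym oner_eq0.
Qed.

HB.instance Definition _ := isBiPointed.Build I clamp01_neq.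

End unit_interval.

Section continuity_helpers.
Context (R : realType) (T U V : topologicalType).

Lemma cts_comp (f : T -> U) (g : U -> V) :
  continuous f -> continuous g -> continuous (fun x => g (f x)).
Proof. by move=> cf cg x; apply: continuous_comp; [exact: cf|exact: cg]. Qed.

Lemma cts_cst (y : U) : continuous (fun _ : T => y).
Proof. by move=> x; exact: cvg_cst. Qed.

Lemma cts_pair (f : T -> U) (g : T -> V) :
  continuous f -> continuous g -> continuous (fun x => (f x, g x)).
Proof. by move=> cf cg x; apply: cvg_pair; [exact: cf|exact: cg]. Qed.

Lemma cts_fst : continuous (fun u : T * U => u.1).
Proof. by move=> u; exact: cvg_fst. Qed.

Lemma cts_snd : continuous (fun u : T * U => u.2).
Proof. by move=> u; exact: cvg_snd. Qed.

Context (f g : T -> R) (cf : continuous f) (cg : continuous g).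

Lemma cts_add : continuous (fun x => f x + g x).
Proof. by move=> x; apply: cvgD; [exact: cf|exact: cg]. Qed.

Lemma cts_sub : continuous (fun x => f x - g x).
Proof. by move=> x; apply: cvgB; [exact: cf|exact: cg]. Qed.

Lemma cts_mul : continuous (fun x => f x * g x).
Proof. by move=> x; apply: cvgM; [exact: cf|exact: cg]. Qed.

End continuity_helpers.

Lemma paste_continuous (R : realType) (T U : topologicalType) (phi : T -> R)
    (c : R) (f g : T -> U) :
  continuous phi -> continuous f -> continuous g ->
  (forall t, phi t = c -> f t = g t) ->
  continuous (fun t => if phi t <= c then f t else g t).
Proof.
move=> cphi cf cg fg.
pose A := [set t | phi t <= c]; pose B := [set t | c <= phi t].
have cA : closed A by apply: (@closed_comp _ _ phi [set x | x <= c]) => //; exact: closed_le.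
have cB : closed B by apply: (@closed_comp _ _ phi [set x | c <= x]) => //; exact: closed_ge.
have AB : A `|` B = setT.
  apply/seteqP; split => // t _; rewrite /A /B /=.
  by case/orP: (le_total (phi t) c); [left|right].
set h := fun t => _.
apply/continuous_subspace_setT; rewrite -AB.
apply: withinU_continuous => //.
- apply: (@subspace_eq_continuous _ A _ f h).
    by move=> t /set_mem; rewrite /A/h/= => ->.
  exact: continuous_subspaceT.
- apply: (@subspace_eq_continuous _ B _ g h); last exact: continuous_subspaceT.
  move=> t /set_mem; rewrite /B/h/= => ct; case: ifPn => // tc.
  by symmetry; apply/fg/le_anti; rewrite tc ct.
Qed.

Section loops.
Context (R : realType) (X : ptopologicalType).
Local Notation I := (unitI R).

Definition loop := {path I from (point : X) to (point : X)}.

HB.instance Definition _ := Choice.on loop.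

Definition loop_homotopic (a b : loop) : Prop :=
  exists2 H : I * I -> X, continuous H &
    [/\ forall s, H (s, zero) = a s, forall s, H (s, one) = b s,
        forall t, H (zero, t) = point & forall t, H (one, t) = point].

Lemma half_lt1 : (1 <= 2^-1 :> R) = false.
Proof. by apply/negbTE; rewrite -ltNge invf_lt1 ?ltr1n. Qed.

Definition loop_cat_fun (a b : loop) (s : I) : X :=
  if ival s <= 2^-1 then a (clamp (2 * ival s)) else b (clamp (2 * ival s - 1)).

Lemma ival0 : ival (zero : I) = 0. Proof. by rewrite clampE// lexx ler01. Qed.
Lemma ival1 : ival (one : I) = 1. Proof. by rewrite clampE// lexx ler01. Qed.

Lemma loop_cat_continuous (a b : loop) : continuous (loop_cat_fun a b).
Proof.
have c2 : continuous (fun s : I => 2 * ival s).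
  by apply: cts_mul; [exact: cts_cst|exact: ival_continuous].
apply: (@paste_continuous _ _ _ ival _
  (fun s => a (clamp (2 * ival s))) (fun s => b (clamp (2 * ival s - 1)))).
- exact: ival_continuous.
- apply: (cts_comp (cts_comp c2 clamp_continuous)); exact: cts_fun.
- apply: (cts_comp (cts_comp (cts_sub c2 (@cts_cst _ _ _)) clamp_continuous)).
  exact: cts_fun.
- move=> s ->; rewrite divff ?pnatr_eq0// subrr.
  by rewrite -/(one : I) -/(zero : I) path_one path_zero.
Qed.

Lemma loop_cat0 (a b : loop) : loop_cat_fun a b zero = point.
Proof.
rewrite /loop_cat_fun ival0 invr_ge0 ler0n mulr0.
exact: path_zero.
Qed.

Lemma loop_cat1 (a b : loop) : loop_cat_fun a b one = point.
Proof.
rewrite /loop_cat_fun ival1 half_lt1 mulr1.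
rewrite (_ : 2 - 1 = 1); last by ring.
exact: path_one.
Qed.

Definition loop_cat (a b : loop) : loop :=
  mk_path (@loop_cat_continuous a b) (loop_cat0 a b) (loop_cat1 a b).

Lemma loop_rev_continuous (a : loop) :
  continuous (fun s : I => a (clamp (1 - ival s))).
Proof.
apply: (cts_comp (cts_comp (cts_sub (@cts_cst _ _ _) ival_continuous)
  clamp_continuous)).
exact: cts_fun.
Qed.

Lemma loop_rev0 (a : loop) : a (clamp (1 - ival (zero : I))) = point.
Proof. by rewrite ival0 subr0; exact: path_one. Qed.

Lemma loop_rev1 (a : loop) : a (clamp (1 - ival (one : I))) = point.
Proof. by rewrite ival1 subrr; exact: path_zero. Qed.

Definition loop_rev (a : loop) : loop :=
  mk_path (@loop_rev_continuous a) (loop_rev0 a) (loop_rev1 a).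

Definition loop_cst : loop := [the loop of cst (point : X) : I -> X].

Lemma loop_reparam (f : I -> X) (th et : R -> R) (a b : loop) :
  continuous f -> continuous th -> continuous et ->
  th 0 = et 0 -> th 1 = et 1 ->
  (forall s, a s = f (clamp (th (ival s)))) ->
  (forall s, b s = f (clamp (et (ival s)))) ->
  loop_homotopic a b.
Proof.
move=> cf cth cet e0 e1 af bf.
exists (fun u : I * I => f (clamp
  ((1 - ival u.2) * th (ival u.1) + ival u.2 * et (ival u.1)))).
  have c1 (g : R -> R) : continuous g ->
      continuous (fun u : I * I => g (ival u.1)).
    exact: (cts_comp (cts_comp (@cts_fst _ _) ival_continuous)).
  have c2 : continuous (fun u : I * I => ival u.2).
    exact: (cts_comp (@cts_snd _ _) ival_continuous).
  apply: (cts_comp (cts_comp _ clamp_continuous) cf).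
  apply: cts_add; apply: cts_mul => //; [|exact: c1|exact: c1].
  by apply: cts_sub => //; exact: cts_cst.
split=> [s|s|t|t] /=.
- by rewrite ival0 subr0 mul1r mul0r addr0 af.
- by rewrite ival1 subrr mul1r mul0r add0r bf.
- by rewrite ival0 -e0 -mulrDl subrK mul1r -(@path_zero _ _ _ _ a) af ival0.
- by rewrite ival1 -e1 -mulrDl subrK mul1r -(@path_one _ _ _ _ a) af ival1.
Qed.

Lemma loop_homotopic_refl (a : loop) : loop_homotopic a a.
Proof.
have ci : continuous (fun x : R => x) by move=> x; exact: cvg_id.
by apply: (@loop_reparam a id id) => // [|s|s]; rewrite ?ivalK//; exact: cts_fun.
Qed.

Lemma loop_homotopic_sym (a b : loop) : loop_homotopic a b -> loop_homotopic b a.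
Proof.
move=> [H cH [H0 H1 Hz Ho]].
exists (fun u => H (u.1, clamp (1 - ival u.2))).
  apply: (cts_comp _ cH); apply: cts_pair; first exact: cts_fst.
  apply: (cts_comp _ clamp_continuous); apply: cts_sub; first exact: cts_cst.
  exact: (cts_comp (@cts_snd _ _) ival_continuous).
split=> [s|s|t|t] /=; rewrite ?Hz ?Ho//.
- by rewrite ival0 subr0 H1.
- by rewrite ival1 subrr H0.
Qed.

Lemma loop_homotopic_trans (a b c : loop) :
  loop_homotopic a b -> loop_homotopic b c -> loop_homotopic a c.
Proof.
move=> [H cH [H0 H1 Hz Ho]] [K cK [K0 K1 Kz Ko]].
exists (fun u : I * I => if ival u.2 <= 2^-1 then H (u.1, clamp (2 * ival u.2))
                   else K (u.1, clamp (2 * ival u.2 - 1))).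
  have c2 : continuous (fun u : I * I => ival u.2).
    exact: (cts_comp (@cts_snd _ _) ival_continuous).
  have c3 : continuous (fun u : I * I => 2 * ival u.2).
    by apply: cts_mul => //; exact: cts_cst.
  apply: (@paste_continuous _ _ _ (fun u : I * I => ival u.2) _
    (fun u => H (u.1, clamp (2 * ival u.2)))
    (fun u => K (u.1, clamp (2 * ival u.2 - 1)))) => //.
  - apply: (cts_comp _ cH); apply: cts_pair; first exact: cts_fst.
    exact: (cts_comp c3 clamp_continuous).
  - apply: (cts_comp _ cK); apply: cts_pair; first exact: cts_fst.
    by apply: (cts_comp (cts_sub c3 (@cts_cst _ _ _)) clamp_continuous).
  - by move=> u ->; rewrite divff ?pnatr_eq0// subrr H1 K0.
split=> [s|s|t|t] /=; rewrite ?Hz ?Ho ?Kz ?Ko ?if_same//.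
- by rewrite ival0 invr_ge0 ler0n mulr0 H0.
- rewrite ival1 half_lt1 mulr1 (_ : 2 - 1 = 1) ?K1//.
  by ring.
Qed.

Lemma loop_cat_homotopic (a a' b b' : loop) :
  loop_homotopic a a' -> loop_homotopic b b' ->
  loop_homotopic (loop_cat a b) (loop_cat a' b').
Proof.
move=> [H cH [H0 H1 Hz Ho]] [K cK [K0 K1 Kz Ko]].
exists (fun u : I * I => if ival u.1 <= 2^-1 then H (clamp (2 * ival u.1), u.2)
                   else K (clamp (2 * ival u.1 - 1), u.2)).
  have c2 : continuous (fun u : I * I => ival u.1).
    exact: (cts_comp (@cts_fst _ _) ival_continuous).
  have c3 : continuous (fun u : I * I => 2 * ival u.1).
    by apply: cts_mul => //; exact: cts_cst.
  apply: (@paste_continuous _ _ _ (fun u : I * I => ival u.1) _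
    (fun u => H (clamp (2 * ival u.1), u.2))
    (fun u => K (clamp (2 * ival u.1 - 1), u.2))) => //.
  - apply: (cts_comp _ cH); apply: cts_pair; last exact: cts_snd.
    exact: (cts_comp c3 clamp_continuous).
  - apply: (cts_comp _ cK); apply: cts_pair; last exact: cts_snd.
    by apply: (cts_comp (cts_sub c3 (@cts_cst _ _ _)) clamp_continuous).
  - by move=> u ->; rewrite divff ?pnatr_eq0// subrr Ho Kz.
split=> [s|s|t|t] /=.
- by rewrite H0 K0.
- by rewrite H1 K1.
- by rewrite ival0 invr_ge0 ler0n mulr0 Hz.
- rewrite ival1 half_lt1 mulr1 (_ : 2 - 1 = 1) ?Ko//.
  by ring.
Qed.

Lemma loop_rev_homotopic (a b : loop) :
  loop_homotopic a b -> loop_homotopic (loop_rev a) (loop_rev b).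
Proof.
move=> [H cH [H0 H1 Hz Ho]].
exists (fun u => H (clamp (1 - ival u.1), u.2)).
  apply: (cts_comp _ cH); apply: cts_pair; last exact: cts_snd.
  apply: (cts_comp _ clamp_continuous); apply: cts_sub; first exact: cts_cst.
  exact: (cts_comp (@cts_fst _ _) ival_continuous).
split=> [s|s|t|t] /=; rewrite ?H0 ?H1//.
- by rewrite ival0 subr0 Ho.
- by rewrite ival1 subrr Hz.
Qed.

Lemma loop_catE (a b : loop) (x : R) : 0 <= x <= 1 ->
  loop_cat a b (clamp x) =
  if x <= 2^-1 then a (clamp (2 * x)) else b (clamp (2 * x - 1)).
Proof. by move=> x01; rewrite /= /mk_path /loop_cat_fun clampE. Qed.

Lemma min_continuous_fun (f g : R -> R) :
  continuous f -> continuous g -> continuous (fun x => Num.min (f x) (g x)).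
Proof. by move=> cf cg x; apply: continuous_min; [exact: cf|exact: cg]. Qed.

Lemma max_continuous_fun (f g : R -> R) :
  continuous f -> continuous g -> continuous (fun x => Num.max (f x) (g x)).
Proof. by move=> cf cg x; apply: continuous_max; [exact: cf|exact: cg]. Qed.

Lemma affine_continuous (p q : R) : continuous (fun x : R => p * x + q).
Proof.
apply: cts_add; last exact: cts_cst.
by apply: cts_mul; [exact: cts_cst|move=> x; exact: cvg_id].
Qed.

Lemma idR_continuous : continuous (fun x : R => x).
Proof. by move=> x; exact: cvg_id. Qed.

Lemma loop_catA (a b c : loop) :
  loop_homotopic (loop_cat a (loop_cat b c)) (loop_cat (loop_cat a b) c).
Proof.
apply: loop_homotopic_sym.
apply: (@loop_reparam (loop_cat a (loop_cat b c))
  (fun x => Num.min (Num.min (2 * x + 0) (1 * x + 4^-1)) (2^-1 * x + 2^-1)) id).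
- exact: cts_fun.
- by do ?apply: min_continuous_fun; exact: affine_continuous.
- exact: idR_continuous.
- by rewrite /Num.min; do ?case: ifPn; rewrite -?leNgt => *; lra.
- by rewrite /Num.min; do ?case: ifPn; rewrite -?leNgt => *; lra.
- move=> s; rewrite -{1}(ivalK s).
  have [x0 x1] := (ival_ge0 s, ival_le1 s); move: (ival s) x0 x1 => x x0 x1.
  rewrite [LHS]loop_catE ?x0//.
  have [x4|x4] := leP x 4^-1.
    rewrite (_ : Num.min _ _ = 2 * x); last first.
      by rewrite /Num.min; do ?case: ifPn; rewrite -?leNgt => *; lra.
    rewrite ifT; last lra.
    rewrite !(@loop_catE a); [|lra..].
    by rewrite !ifT//; lra.
  have [x2|x2] := leP x 2^-1.
    rewrite (_ : Num.min _ _ = x + 4^-1); last first.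
      by rewrite /Num.min; do ?case: ifPn; rewrite -?leNgt => *; lra.
    rewrite !(@loop_catE a); [|lra..].
    rewrite ifF; last by apply/negbTE; rewrite -ltNge; lra.
    rewrite [RHS]ifF; last by apply/negbTE; rewrite -ltNge; lra.
    rewrite loop_catE; last lra.
    rewrite ifT; last lra.
    by congr (b (clamp _)); lra.
  rewrite (_ : Num.min _ _ = 2^-1 * x + 2^-1); last first.
    by rewrite /Num.min; do ?case: ifPn; rewrite -?leNgt => *; lra.
  rewrite loop_catE; last lra.
  rewrite [RHS]ifF; last by apply/negbTE; rewrite -ltNge; lra.
  rewrite loop_catE; last lra.
  rewrite ifF; last by apply/negbTE; rewrite -ltNge; lra.
  by congr (c (clamp _)); lra.
- by move=> s; rewrite ivalK.
Qed.

Lemma loop_cat1l (a : loop) : loop_homotopic (loop_cat loop_cst a) a.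
Proof.
apply: (@loop_reparam a (fun x => Num.max 0 (2 * x + - 1)) id).
- exact: cts_fun.
- apply: (@max_continuous_fun (fun=> 0)); first exact: cts_cst.
  exact: affine_continuous.
- exact: idR_continuous.
- by rewrite /Num.max; case: ifPn; rewrite -?leNgt => *; lra.
- by rewrite /Num.max; case: ifPn; rewrite -?leNgt => *; lra.
- move=> s; rewrite -{1}(ivalK s) [LHS]loop_catE ?ival_ge0 ?ival_le1//.
  case: ifPn => x2; last by rewrite max_r//; lra.
  by rewrite max_l; [rewrite -[LHS](@path_zero _ _ _ _ a)|lra].
- by move=> s; rewrite ivalK.
Qed.

Lemma loop_cat1r (a : loop) : loop_homotopic (loop_cat a loop_cst) a.
Proof.
apply: (@loop_reparam a (fun x => Num.min 1 (2 * x + 0)) id).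
- exact: cts_fun.
- apply: (@min_continuous_fun (fun=> 1)); first exact: cts_cst.
  exact: affine_continuous.
- exact: idR_continuous.
- by rewrite /Num.min; case: ifPn; rewrite -?leNgt => *; lra.
- by rewrite /Num.min; case: ifPn; rewrite -?leNgt => *; lra.
- move=> s; rewrite -{1}(ivalK s) [LHS]loop_catE ?ival_ge0 ?ival_le1//.
  case: ifPn => x2; first by rewrite min_r addr0//; lra.
  by rewrite min_l; [rewrite -[LHS](@path_one _ _ _ _ a)|lra].
- by move=> s; rewrite ivalK.
Qed.

Lemma loop_catVr (a : loop) : loop_homotopic (loop_cat a (loop_rev a)) loop_cst.
Proof.
apply: (@loop_reparam a (fun x => Num.min (2 * x + 0) (- 2 * x + 2))
  (fun=> 0)).
- exact: cts_fun.
- by apply: min_continuous_fun; exact: affine_continuous.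
- by move=> x; exact: cvg_cst.
- by rewrite /Num.min; case: ifPn; rewrite -?leNgt => *; lra.
- by rewrite /Num.min; case: ifPn; rewrite -?leNgt => *; lra.
- move=> s; rewrite -{1}(ivalK s) [LHS]loop_catE ?ival_ge0 ?ival_le1//.
  have [x0 x1] := (ival_ge0 s, ival_le1 s); move: (ival s) x0 x1 => x x0 x1.
  case: ifPn => x2; first by rewrite min_l addr0//; lra.
  rewrite min_r /= ?/mk_path ?clampE; [|lra..].
  by congr (a (clamp _)); lra.
- by move=> s; rewrite -[LHS](@path_zero _ _ _ _ a).
Qed.

Lemma loop_revK (a : loop) : loop_rev (loop_rev a) = a.
Proof.
apply/path_eqP => s /=; rewrite /mk_path clampE; last first.
  by rewrite subr_ge0 ival_le1 gerBl ival_ge0.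
by rewrite subKr ivalK.
Qed.

Definition loop_eqv : rel loop := fun a b => `[< loop_homotopic a b >].

Lemma loop_eqv_refl : reflexive loop_eqv.
Proof. by move=> a; apply/asboolP/loop_homotopic_refl. Qed.

Lemma loop_eqv_sym : symmetric loop_eqv.
Proof.
by move=> a b; apply/asboolP/asboolP => /loop_homotopic_sym.
Qed.

Lemma loop_eqv_trans : transitive loop_eqv.
Proof.
by move=> b a c /asboolP ab /asboolP bc; apply/asboolP/(loop_homotopic_trans ab).
Qed.

Canonical loop_equiv_rel :=
  EquivRel loop_eqv loop_eqv_refl loop_eqv_sym loop_eqv_trans.

Definition pi1 : Type := {eq_quot loop_equiv_rel}.

HB.instance Definition _ := Choice.on pi1.

Definition pi1_class (a : loop) : pi1 := \pi_({eq_quot loop_equiv_rel}) a.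

Lemma pi1_classP (a b : loop) : pi1_class a = pi1_class b <-> loop_homotopic a b.
Proof.
split=> [/eqmodP/asboolP//|ab].
by apply/eqmodP/asboolP.
Qed.

Lemma pi1_reprK (u : pi1) : pi1_class (repr u) = u.
Proof. exact: reprK. Qed.

Lemma repr_pi1_class (a : loop) : loop_homotopic (repr (pi1_class a)) a.
Proof. by apply/pi1_classP; rewrite pi1_reprK. Qed.

Definition pi1_mul (u v : pi1) : pi1 := pi1_class (loop_cat (repr u) (repr v)).
Definition pi1_inv (u : pi1) : pi1 := pi1_class (loop_rev (repr u)).
Definition pi1_one : pi1 := pi1_class loop_cst.

Lemma pi1_mulE (a b : loop) :
  pi1_mul (pi1_class a) (pi1_class b) = pi1_class (loop_cat a b).
Proof. by apply/pi1_classP/loop_cat_homotopic; exact: repr_pi1_class. Qed.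

Lemma pi1_invE (a : loop) : pi1_inv (pi1_class a) = pi1_class (loop_rev a).
Proof. by apply/pi1_classP/loop_rev_homotopic; exact: repr_pi1_class. Qed.

Lemma pi1_mulA : associative pi1_mul.
Proof.
move=> u v w; rewrite -(pi1_reprK u) -(pi1_reprK v) -(pi1_reprK w) !pi1_mulE.
exact/pi1_classP/loop_catA.
Qed.

Lemma pi1_mul1g : left_id pi1_one pi1_mul.
Proof.
by move=> u; rewrite -(pi1_reprK u) pi1_mulE; exact/pi1_classP/loop_cat1l.
Qed.

Lemma pi1_mulg1 : right_id pi1_one pi1_mul.
Proof.
by move=> u; rewrite -(pi1_reprK u) pi1_mulE; exact/pi1_classP/loop_cat1r.
Qed.

Lemma pi1_mulgV : right_inverse pi1_one pi1_inv pi1_mul.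
Proof.
move=> u; rewrite -(pi1_reprK u) pi1_invE pi1_mulE.
exact/pi1_classP/loop_catVr.
Qed.

Lemma pi1_mulVg : left_inverse pi1_one pi1_inv pi1_mul.
Proof.
move=> u; rewrite -(pi1_reprK u) pi1_invE pi1_mulE -{2}[repr u]loop_revK.
exact/pi1_classP/loop_catVr.
Qed.

HB.instance Definition _ := isGroup.Build pi1
  pi1_mulA pi1_mul1g pi1_mulg1 pi1_mulVg pi1_mulgV.

Lemma pi1_classM (a b : loop) :
  (pi1_class a * pi1_class b)%g = pi1_class (loop_cat a b).
Proof. exact: pi1_mulE. Qed.

End loops.

Record ptmap (X Y : ptopologicalType) := PtMap {
  ptmap_fun :> X -> Y;
  ptmap_continuous : continuous ptmap_fun;
  ptmap_point : ptmap_fun point = point }.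

Section induced_map.
Context (R : realType) (X Y : ptopologicalType) (f : ptmap X Y).
Local Notation I := (unitI R).

Lemma loop_map_continuous (a : loop R X) : continuous (f \o a).
Proof.
by move=> s; apply: continuous_comp; [exact: cts_fun|exact: ptmap_continuous].
Qed.

Lemma loop_map0 (a : loop R X) : (f \o a) zero = point.
Proof. by rewrite /= path_zero ptmap_point. Qed.

Lemma loop_map1 (a : loop R X) : (f \o a) one = point.
Proof. by rewrite /= path_one ptmap_point. Qed.

Definition loop_map (a : loop R X) : loop R Y :=
  mk_path (@loop_map_continuous a) (loop_map0 a) (loop_map1 a).

Lemma loop_map_homotopic (a b : loop R X) :
  loop_homotopic a b -> loop_homotopic (loop_map a) (loop_map b).
Proof.
move=> [H cH [H0 H1 Hz Ho]]; exists (f \o H).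
  by move=> u; apply: continuous_comp; [exact: cH|exact: ptmap_continuous].
by split=> [s|s|t|t] /=; rewrite ?H0 ?H1 ?Hz ?Ho ?ptmap_point.
Qed.

Definition pi1_map (u : pi1 R X) : pi1 R Y := pi1_class (loop_map (repr u)).

Lemma pi1_mapE (a : loop R X) : pi1_map (pi1_class a) = pi1_class (loop_map a).
Proof. exact/pi1_classP/loop_map_homotopic/repr_pi1_class. Qed.

Lemma pi1_mapM : {morph pi1_map : u v / (u * v)%g}.
Proof.
move=> u v; rewrite -(pi1_reprK u) -(pi1_reprK v).
move: (repr u) (repr v) => a b.
rewrite pi1_classM !pi1_mapE pi1_classM; congr pi1_class; apply/path_eqP => s /=.
by rewrite /mk_path /loop_cat_fun /=; case: ifP.
Qed.

HB.instance Definition _ := isMultiplicative.Build _ _ pi1_map pi1_mapM.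

End induced_map.
Arguments pi1_map R {X Y} f u.

Definition subgroup (T : groupType) (H : set T) : Prop :=
  group_closed (mem H).

Section fibrations.
Context (R : realType).
Local Notation I := (unitI R).

(* Homotopy lifting property with respect to every space [Z]; neither [Z] nor
   the homotopies are pointed. *)
Definition hurewicz_fibration (E B : topologicalType) (p : E -> B) : Prop :=
  continuous p /\
  forall (Z : topologicalType) (h : Z -> E) (K : Z * I -> B),
    continuous h -> continuous K -> (forall z, K (z, zero) = p (h z)) ->
    exists L : Z * I -> E,
      [/\ continuous L, forall z, L (z, zero) = h z & p \o L = K].

(* A path in the fiber over [b] is a path [c] of [E] with [p \o c] constantly
   equal to [b]. *)
Definition rigid_fibration (E B : topologicalType) (p : E -> B) : Prop :=
  hurewicz_fibration p /\
  forall (b : B) (c : I -> E), continuous c -> (forall s, p (c s) = b) ->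
    forall s t, c s = c t.

Definition path_connected (T : topologicalType) (A : set T) : Prop :=
  forall x y, A x -> A y ->
    exists c : {path I from x to y}, forall s, A (c s).

Definition locally_path_connected (T : topologicalType) : Prop :=
  forall (x : T) (U : set T), nbhs x U ->
    exists V : set T, [/\ open V, V x, V `<=` U & path_connected V].

End fibrations.
Arguments hurewicz_fibration R {E B} p.
Arguments rigid_fibration R {E B} p.
Arguments path_connected R {T} A.

(* Main.v *)
Require Import Defs.
From HB Require Import structures.
From mathcomp Require Import all_boot all_order all_algebra.
From mathcomp Require Import ring lra.
From mathcomp Require Import all_classical all_reals all_analysis.
From mathcomp Require Import homotopy.

Set Implicit Arguments.
Unset Strict Implicit.
Unset Printing Implicit Defensive.

Import Order.TTheory GRing.Theory Num.Theory.
Import numFieldNormedType.Exports.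

Local Open Scope classical_set_scope.

(** The three parts rest on unique path lifting, which rigidity provides
    ([rigid_unique_path_lifting]).  If two paths [a], [b] start at the same point
    and have the same image under [p], then the path that runs [a] backwards and
    then [b] has an image of the form [c^-1 c].  That image contracts onto
    its end points, and a lift of the contraction moves, along the three free
    sides of the square, inside one fiber; as it cannot move there, the ends of
    [a] and [b] coincide.

    Part (iii) is functoriality of the fundamental group.  For part (ii),
    [q \o f = g \o p] is a rigid fibration, being a composite of two; a homotopy
    in [EG] is lifted through it after applying [q], and unique path lifting for
    [q] shows that this lift, once mapped by [f], is the homotopy given
    ([rigid_fibration_factor]).

    Part (i) is the lifting criterion for [phi = g \o p]
    ([rigid_fibration_lifting]).  The graph of the lift is the path component of
    the base point in the pullback of [phi] and [q], which is what [transport]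
    describes.  It meets every fiber over the path connected source
    because paths lift, and only once ([transport_fun]) because a loop whose class is sent into
    the image of [q] lifts to a loop ([loop_lifting]).  Continuity
    cannot come from evenly covered neighbourhoods, since a rigid fibration
    need not have any; it comes from the homotopy lifting property itself,
    applied to the universal homotopy that moves a point along the paths
    issuing from [e0] ([transport_continuous]).  Lifting this single homotopy lifts
    all these paths at once, continuously in the path, and local path
    connectedness says that points near [e0] are ends of paths near the constant
    one. *)

Lemma cts_max (R : realType) (T : topologicalType) (f g : T -> R) :
  continuous f -> continuous g -> continuous (fun x => Num.max (f x) (g x)).
Proof. by move=> cf cg x; apply: continuous_max; [exact: cf|exact: cg]. Qed.

(** * Concatenating, reversing and halving paths *)

Section path_operations.
Local Open Scope ring_scope.
Context {R : realType} {T : topologicalType}.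
Local Notation I := (unitI R).
Implicit Types a b : I -> T.

Definition path_cat a b (s : I) : T :=
  if ival s <= 2^-1 then a (clamp (2 * ival s)) else b (clamp (2 * ival s - 1)).

Definition path_rev a (s : I) : T := a (clamp (1 - ival s)).

Definition first_half a (s : I) : T := a (clamp (2^-1 * ival s)).

Definition second_half a (s : I) : T := a (clamp (2^-1 + 2^-1 * ival s)).

Lemma reparam_continuous a (u : I -> R) :
  continuous a -> continuous u -> continuous (fun s => a (clamp (u s))).
Proof. by move=> ca cu; exact: (cts_comp (cts_comp cu clamp_continuous) ca). Qed.

Lemma scale_ival_continuous (r : R) : continuous (fun s : I => r * ival s).
Proof. by apply: cts_mul; [exact: cts_cst|exact: ival_continuous]. Qed.

Lemma path_cat_continuous a b : continuous a -> continuous b ->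
  a one = b zero -> continuous (path_cat a b).
Proof.
move=> ca cb ab.
apply: (@paste_continuous _ _ _ ival _
  (fun s => a (clamp (2 * ival s))) (fun s => b (clamp (2 * ival s - 1)))).
- exact: ival_continuous.
- exact/(reparam_continuous ca)/scale_ival_continuous.
- apply: (reparam_continuous cb); apply: cts_sub; last exact: cts_cst.
  exact: scale_ival_continuous.
- by move=> s ->; rewrite divff ?pnatr_eq0// subrr.
Qed.

Lemma path_rev_continuous a : continuous a -> continuous (path_rev a).
Proof.
move=> ca; apply: (reparam_continuous ca).
by apply: cts_sub; [exact: cts_cst|exact: ival_continuous].
Qed.

Lemma first_half_continuous a : continuous a -> continuous (first_half a).
Proof. by move=> ca; exact/(reparam_continuous ca)/scale_ival_continuous. Qed.

Lemma second_half_continuous a : continuous a -> continuous (second_half a).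
Proof.
move=> ca; apply: (reparam_continuous ca); apply: cts_add; first exact: cts_cst.
exact: scale_ival_continuous.
Qed.

Lemma path_cat_zero a b : path_cat a b zero = a zero.
Proof. by rewrite /path_cat ival0 invr_ge0 ler0n mulr0. Qed.

Lemma path_cat_one a b : path_cat a b one = b one.
Proof.
rewrite /path_cat ival1 half_lt1 mulr1.
by rewrite (_ : 2 - 1 = 1); last by ring.
Qed.

Lemma path_rev_zero a : path_rev a zero = a one.
Proof. by rewrite /path_rev ival0 subr0. Qed.

Lemma path_rev_one a : path_rev a one = a zero.
Proof. by rewrite /path_rev ival1 subrr. Qed.

Lemma path_revK a : path_rev (path_rev a) = a.
Proof.
apply/funext => s; rewrite /path_rev clampE.
  by rewrite subKr ivalK.
by rewrite subr_ge0 ival_le1 gerBl ival_ge0.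
Qed.

Lemma first_half_zero a : first_half a zero = a zero.
Proof. by rewrite /first_half ival0 mulr0. Qed.

Lemma first_half_one a : first_half a one = second_half a zero.
Proof. by rewrite /first_half /second_half ival0 ival1 mulr0 mulr1 addr0. Qed.

Lemma second_half_one a : second_half a one = a one.
Proof.
rewrite /second_half ival1 mulr1.
by rewrite (_ : 2^-1 + 2^-1 = 1)//; lra.
Qed.

Lemma first_half_cat a b : first_half (path_cat a b) = a.
Proof.
apply/funext => s; have [s0 s1] := (ival_ge0 s, ival_le1 s).
rewrite /first_half /path_cat clampE; last lra.
rewrite ifT; last lra.
by rewrite mulrA divff ?pnatr_eq0// mul1r ivalK.
Qed.

(** The junction hypothesis is what makes the second half correct at time 0:
    [path_cat] gives the midpoint to its first argument. *)
Lemma second_half_cat a b : a one = b zero -> second_half (path_cat a b) = b.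
Proof.
move=> ab; apply/funext => s; have [s0 s1] := (ival_ge0 s, ival_le1 s).
rewrite /second_half /path_cat clampE; last lra.
case: ifPn => sh; last first.
  by rewrite -[in RHS](ivalK s); congr (b (clamp _)); lra.
have s00 : ival s = 0 by lra.
rewrite (_ : s = zero); last by apply: ival_inj; rewrite s00 ival0.
by rewrite -ab; congr (a _); rewrite ival0 /one/=; congr clamp; lra.
Qed.

End path_operations.

(** * Unique path lifting *)

Section unique_path_lifting.
Local Open Scope ring_scope.
Context {R : realType} {E B : topologicalType} {p : E -> B}.
Local Notation I := (unitI R).
Context (rigid_p : rigid_fibration R p).

Lemma rigid_fiber_path (c : I -> E) (b : B) : continuous c ->
  (forall s, p (c s) = b) -> forall s t, c s = c t.
Proof. by move=> cc cb; exact: (rigid_p.2 b c cc cb). Qed.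

(** This is homotopy lifting over a one-point space; [bool] serves as well,
    with both points following the same path. *)
Lemma rigid_path_lifting (c : I -> B) (e : E) : continuous c -> c zero = p e ->
  exists2 d : I -> E, continuous d & d zero = e /\ p \o d = c.
Proof.
move=> cc c0.
have [L [cL L0 pL]] := rigid_p.1.2 bool (fun=> e) (fun u : bool * I => c u.2)
  (@cts_cst _ _ e) (cts_comp (@cts_snd _ _) cc) (fun=> c0).
exists (fun s => L (true, s)).
  by apply: (cts_comp _ cL); apply: cts_pair; [exact: cts_cst|move=> s; exact: cvg_id].
by split=> //; apply/funext => s; have /(congr1 (@^~ (true, s))) := pL.
Qed.

(** The contraction of the path [c^-1 c], where [c] is the common image, is
    [c (max |1 - 2 s| t)]: at time [t] only the part of [c] after [t] is
    retraced.  Its lift stays in one fiber on the left, top and right sides of the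
    square, so the lift takes the same value at the two bottom corners, where it
    is the end of [a] and the end of [b]. *)
Lemma rigid_lift_end (a b : I -> E) : continuous a -> continuous b ->
  a zero = b zero -> p \o a = p \o b -> a one = b one.
Proof.
move=> ca cb ab0 pab.
have junction : path_rev a one = b zero by rewrite path_rev_one.
pose w := path_cat (path_rev a) b.
have cw : continuous w.
  by apply: path_cat_continuous => //; exact: path_rev_continuous.
pose K (u : I * I) : B :=
  p (a (clamp (Num.max (Num.max (1 - 2 * ival u.1) (2 * ival u.1 - 1)) (ival u.2)))).
have c2 : continuous (fun u : I * I => 2 * ival u.1).
  exact: (cts_comp (@cts_fst _ _) (@scale_ival_continuous R 2)).
have cK : continuous K.
  apply: (cts_comp (cts_comp (cts_comp _ clamp_continuous) ca) rigid_p.1.1).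
  apply: cts_max; last exact: (cts_comp (@cts_snd _ _) ival_continuous).
  by apply: cts_max; apply: cts_sub => //; exact: cts_cst.
have K0 s : K (s, zero) = p (w s).
  have [s0 s1] := (ival_ge0 s, ival_le1 s).
  have pE t : p (b t) = p (a t) by have /(congr1 (@^~ t)) := pab.
  rewrite /K /w /path_cat /path_rev /= ival0.
  case: ifPn => sh; last first.
    by rewrite pE max_l ?max_r//; rewrite ?le_max; lra.
  rewrite clampE; last lra.
  by rewrite max_l ?max_l//; rewrite ?le_max; lra.
have [L [cL L0 pL]] := rigid_p.1.2 I w K cw cK K0.
have pLE u : p (L u) = K u by rewrite -pL.
have fiber (c : I -> I * I) : continuous c ->
    (forall s, K (c s) = p (a one)) -> forall s t, L (c s) = L (c t).
  by move=> cc Kc; apply: rigid_fiber_path (cts_comp cc cL) _ => s; rewrite pLE.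
have cid : continuous (fun s : I => s) by move=> s; exact: cvg_id.
(* the maximum in [K] is 1 on the three sides other than the bottom *)
have left := fiber (fun s => (zero, s)) (cts_pair (@cts_cst _ _ _) cid).
have right := fiber (fun s => (one, s)) (cts_pair (@cts_cst _ _ _) cid).
have top := fiber (fun s => (s, one)) (cts_pair cid (@cts_cst _ _ _)).
have Kmax r t : r \in [:: zero; one] -> K (r, t) = p (a one).
  have [t0 t1] := (ival_ge0 t, ival_le1 t).
  rewrite !inE /K => /orP[]/eqP->/=; rewrite ?ival0 ?ival1.
    rewrite (_ : Num.max _ _ = 1)//.
    by rewrite [Num.max (1 - _) _]max_l ?max_l; lra.
  rewrite (_ : Num.max _ _ = 1)//.
  by rewrite [Num.max (1 - _) _]max_r ?max_l; lra.
have Ktop s : K (s, one) = p (a one).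
  have [s0 s1] := (ival_ge0 s, ival_le1 s).
  by rewrite /K /= ival1 max_r// ge_max; lra.
transitivity (L (zero, zero)); first by rewrite L0 /w path_cat_zero path_rev_zero.
rewrite (left _ zero one); last by move=> s; rewrite Kmax ?inE ?eqxx.
rewrite (top _ zero one)//.
rewrite (right _ one zero); last by move=> s; rewrite Kmax ?inE ?eqxx ?orbT.
by rewrite L0 /w path_cat_one.
Qed.

(** Equality at time [t] is equality of the ends of the initial segments of
    length [t]. *)
Lemma rigid_unique_path_lifting (a b : I -> E) : continuous a -> continuous b ->
  a zero = b zero -> p \o a = p \o b -> a = b.
Proof.
move=> ca cb ab0 pab; apply/funext => t.
have initial (c : I -> E) : continuous c ->
    continuous (fun s => c (clamp (ival t * ival s))).
  by move=> cc; exact/(reparam_continuous cc)/scale_ival_continuous.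
have := rigid_lift_end (initial a ca) (initial b cb).
rewrite ival0 ival1 mulr0 mulr1 ivalK; apply => //.
by apply/funext => s; exact: (congr1 (@^~ (clamp (ival t * ival s))) pab).
Qed.

End unique_path_lifting.

(** * Rigid fibrations in a commutative square *)

Lemma hurewicz_fibration_comp (R : realType) (E B C : topologicalType)
    (p : E -> B) (g : B -> C) :
  hurewicz_fibration R p -> hurewicz_fibration R g ->
  hurewicz_fibration R (g \o p).
Proof.
move=> [cp lift_p] [cg lift_g]; split; first exact: cts_comp.
move=> Z h K ch cK K0.
have [M [cM M0 gM]] := lift_g Z (p \o h) K (cts_comp ch cp) cK K0.
have [L [cL L0 pL]] := lift_p Z h M ch cM M0.
by exists L; split=> //; rewrite -compA pL.
Qed.

(** A path in a fiber of the composite is sent into a fiber of [g], hence to a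
    point, so it lies in a fiber of [p]. *)
Lemma rigid_fibration_comp (R : realType) (E B C : topologicalType)
    (p : E -> B) (g : B -> C) :
  rigid_fibration R p -> rigid_fibration R g -> rigid_fibration R (g \o p).
Proof.
move=> rp rg; split; first exact: hurewicz_fibration_comp rp.1 rg.1.
move=> b c cc cb s t.
apply: (rigid_fiber_path rp cc (b := p (c t))) => r.
exact: (rigid_fiber_path rg (cts_comp cc rp.1.1) cb).
Qed.

(** The lift through [q \o f] solves the lifting problem for [f]: for each [z],
    its image by [f] and the given homotopy are lifts along [q] of one path, with
    the same origin. *)
Lemma rigid_fibration_factor (R : realType) (E F C : topologicalType)
    (f : E -> F) (q : F -> C) : continuous f -> rigid_fibration R q ->
  rigid_fibration R (q \o f) -> rigid_fibration R f.
Proof.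
move=> cf rq rqf; split; last first.
  move=> b c cc cb.
  by apply: (rigid_fiber_path rqf cc (b := q b)) => s /=; rewrite cb.
split=> // Z h K ch cK K0.
have [|L [cL L0 qfL]] := rqf.1.2 Z h (q \o K) ch (cts_comp cK rq.1.1).
  by move=> z /=; rewrite K0.
exists L; split=> //; apply/funext => -[z s].
have cz : continuous (fun t : unitI R => (z, t)).
  by apply: cts_pair; [exact: cts_cst|move=> t; exact: cvg_id].
have := rigid_unique_path_lifting rq (cts_comp cz (cts_comp cL cf)) (cts_comp cz cK).
move=> /(_ _ _)/(congr1 (@^~ s)); apply; first by rewrite L0 K0.
by apply/funext => t; exact: (congr1 (@^~ (z, t)) qfL).
Qed.

(** * Composition of pointed maps *)

Lemma ptmap_comp_point (X Y Z : ptopologicalType) (g : ptmap Y Z) (f : ptmap X Y) :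
  (g \o f) point = point.
Proof. by rewrite /= !ptmap_point. Qed.

Definition ptmap_comp (X Y Z : ptopologicalType) (g : ptmap Y Z) (f : ptmap X Y) :
    ptmap X Z :=
  PtMap (cts_comp (@ptmap_continuous _ _ f) (@ptmap_continuous _ _ g))
    (ptmap_comp_point g f).

Lemma pi1_map_comp (R : realType) (X Y Z : ptopologicalType)
    (g : ptmap Y Z) (f : ptmap X Y) (h : ptmap X Z) (u : pi1 R X) :
  g \o f = h -> pi1_map R g (pi1_map R f u) = pi1_map R h u.
Proof.
move=> gf; rewrite -(pi1_reprK u) !pi1_mapE; congr pi1_class.
by apply/path_eqP => s; exact: (congr1 (@^~ (repr u s)) gf).
Qed.

(** * Paths issuing from a point, topologized at the constant path *)

Section rooted_path.
Context (R : realType) (T : topologicalType) (x : T).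
Local Notation I := (unitI R).

Definition rooted_path : Type := {c : I -> T | continuous c & c zero = x}.

Definition rooted_eval (z : rooted_path) : I -> T := s2val z.

(** Every path is isolated except the constant one, near which are the
    paths that stay near [x].  This topology is coarse enough at the constant path
    for its neighbourhoods to have all points near [x] as ends in a locally path
    connected space, and otherwise as fine as possible, so that evaluation is
    continuous.  It does the work of the compact-open topology with no argument on
    compact sets. *)
Definition rooted_path_nbhs (z : rooted_path) : set_system rooted_path :=
  [set A | A z /\ ((forall s, rooted_eval z s = x) ->
     exists2 U, nbhs x U &
       forall c, (forall s, U (rooted_eval c s)) -> A c)].

HB.instance Definition _ := gen_eqMixin rooted_path.
HB.instance Definition _ := gen_choiceMixin rooted_path.
HB.instance Definition _ := hasNbhs.Build rooted_path rooted_path_nbhs.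

Lemma rooted_path_nbhs_filter (z : rooted_path) : ProperFilter (nbhs z).
Proof.
apply: Build_ProperFilter_ex; first by move=> A [Az _]; exists z.
split.
- by split=> // _; exists setT => //; exact: filterT.
- move=> A B [Az Au] [Bz Bu]; split=> // zx.
  have [U xU UA] := Au zx; have [V xV VB] := Bu zx.
  exists (U `&` V); first exact: filterI.
  by move=> c cUV; split; [apply: UA => s|apply: VB => s]; case: (cUV s).
- move=> A B AB [Az Au]; split; first exact: AB.
  by move=> /Au[U xU UA]; exists U => // c /UA/AB.
Qed.

Lemma rooted_path_nbhs_singleton (z : rooted_path) (A : set rooted_path) :
  nbhs z A -> A z.
Proof. by case. Qed.

Lemma rooted_path_nbhs_nbhs (z : rooted_path) (A : set rooted_path) :
  nbhs z A -> nbhs z (nbhs^~ A).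
Proof.
move=> zA; split=> // zx; have [_ /(_ zx)[U xU UA]] := zA.
by exists U => // c cU; split; [exact: UA|move=> _; exists U].
Qed.

HB.instance Definition _ := Nbhs_isNbhsTopological.Build rooted_path
  rooted_path_nbhs_filter rooted_path_nbhs_singleton rooted_path_nbhs_nbhs.

Lemma rooted_eval_continuous :
  continuous (fun u : rooted_path * I => rooted_eval u.1 u.2).
Proof.
move=> [z s] W /= zsW.
have cz : continuous (rooted_eval z) by case: z {zsW}.
have [zx|zx] := pselect (forall t, rooted_eval z t = x).
  exists ([set c | forall t, W (rooted_eval c t)], setT) => /=.
    split; last exact: filterT.
    rewrite zx in zsW; split=> [t|_]; last by exists W.
    by rewrite /= zx; exact: nbhs_singleton.
  by move=> [c t] /= [+ _]; exact.
exists ([set z], rooted_eval z @^-1` W) => /=; first by split=> //; exact: cz.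
by move=> [c t] /= [-> ].
Qed.

Definition rooted_cst : rooted_path := exist2 _ _ (fun=> x) (@cts_cst _ _ x) erefl.

End rooted_path.

(** * The lifting criterion *)

Section lifting_criterion.
Context {R : realType} {E F Y : ptopologicalType}.
Context (phi : ptmap E Y) (q : ptmap F Y).
Local Notation I := (unitI R).
Context (rigid_q : rigid_fibration R q).

(** [(e, y)] is in the path component of the base point of the pullback of [phi]
    and [q]: [y] is the end of a lift along [q] of the image of a path to [e]. *)
Definition transport (e : E) (y : F) : Prop :=
  exists w : I -> E * F, [/\ continuous w, w zero = (point, point),
    w one = (e, y) & forall s, q (w s).2 = phi (w s).1].

Lemma transport_point : transport point point.
Proof.
exists (fun=> (point, point)); split=> //; first exact: cts_cst.
by move=> s; rewrite !ptmap_point.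
Qed.

Lemma transport_over (e : E) (y : F) : transport e y -> q y = phi e.
Proof. by move=> [w [_ _ w1 qw]]; have := qw one; rewrite w1. Qed.

Lemma transport_extend (e : E) (y : F) (c : I -> E) (d : I -> F) :
  transport e y -> continuous c -> continuous d ->
  c zero = e -> d zero = y -> q \o d = phi \o c ->
  transport (c one) (d one).
Proof.
move=> [w [cw w0 w1 qw]] cc cd c0 d0 qd.
exists (path_cat w (fun s => (c s, d s))); split.
- apply: path_cat_continuous => //; first exact: cts_pair.
  by rewrite w1 c0 d0.
- by rewrite path_cat_zero.
- by rewrite path_cat_one.
- move=> s; rewrite /path_cat; case: ifP => // _.
  exact: (congr1 (@^~ _) qd).
Qed.

Lemma transport_total : path_connected R [set: E] ->
  forall e, exists y, transport e y.
Proof.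
move=> pcE e; have [c _] := pcE point e Logic.I Logic.I.
have cc : continuous c by exact: cts_fun.
have [||d cd [d0 qd]] := rigid_path_lifting rigid_q (e := point) (c := phi \o c).
- exact: (cts_comp cc (@ptmap_continuous _ _ phi)).
- by rewrite /= path_zero !ptmap_point.
exists (d one); rewrite -(@path_one _ _ _ _ c).
by apply: (transport_extend transport_point) => //; exact: path_zero.
Qed.

(** The homotopy from the image of a loop [a] to the image of [c] lifts to one that
    starts at [a]; on its vertical sides the lift is in the fiber over the base
    point, hence constant, so it ends with a loop. *)
Lemma loop_lifting (c : loop R E) :
  (pi1_map R q @` setT) (pi1_map R phi (pi1_class c)) ->
  exists2 d : I -> F, continuous d &
    [/\ d zero = point, d one = point & q \o d = phi \o c].
Proof.
move=> [u _]; rewrite -(pi1_reprK u) !pi1_mapE => /pi1_classP[M cM [M0 M1 Mz Mo]].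
move: (repr u) M0 => {u} a M0.
have ca : continuous a by exact: cts_fun.
have [L [cL L0 qL]] := rigid_q.1.2 I a M ca cM M0.
have cid : continuous (fun s : I => s) by move=> s; exact: cvg_id.
have side r : (forall t, M (r, t) = point) -> L (r, one) = L (r, zero).
  move=> Mr.
  apply: (rigid_fiber_path rigid_q (cts_comp (cts_pair (@cts_cst _ _ r) cid) cL)
    (b := point)) => t.
  by rewrite -[LHS]/((q \o L) (r, t)) qL.
exists (fun s => L (s, one)).
  exact: (cts_comp (cts_pair cid (@cts_cst _ _ one)) cL).
split; first by rewrite side// L0 path_zero.
- by rewrite side// L0 path_one.
- by apply/funext => s /=; rewrite -[LHS]/((q \o L) (s, one)) qL M1.
Qed.

Context (phi_le_q : pi1_map R phi @` setT `<=` pi1_map R q @` setT).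

(** Going to [e] by the first path and back by the second is a loop, which lifts
    to a loop [d].  The first half of [d] and the reverse of its second half start
    at the base point, so by uniqueness they are the two given lifts; both end at
    the midpoint of [d]. *)
Lemma transport_fun (e : E) (y y' : F) :
  transport e y -> transport e y' -> y = y'.
Proof.
move=> [w [cw w0 w1 qw]] [w' [cw' w'0 w'1 qw']].
pose a := fst \o w; pose a' := fst \o w'.
pose b := snd \o w; pose b' := snd \o w'.
have ca : continuous a by exact: (cts_comp cw (@cts_fst _ _)).
have ca' : continuous a' by exact: (cts_comp cw' (@cts_fst _ _)).
have cb : continuous b by exact: (cts_comp cw (@cts_snd _ _)).
have cb' : continuous b' by exact: (cts_comp cw' (@cts_snd _ _)).
have aa' : a one = path_rev a' zero by rewrite path_rev_zero /a/a'/= w1 w'1.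
have cat_cts := path_cat_continuous ca (path_rev_continuous ca') aa'.
have cat0 : path_cat a (path_rev a') zero = point.
  by rewrite path_cat_zero /a/= w0.
have cat1 : path_cat a (path_rev a') one = point.
  by rewrite path_cat_one path_rev_one /a'/= w'0.
pose c : loop R E := mk_path cat_cts cat0 cat1.
have [|d cd [d0 d1 qd]] := @loop_lifting c.
  by apply: phi_le_q; exists (pi1_class c).
have ab : first_half d = b.
  apply: (rigid_unique_path_lifting rigid_q) => //.
  - exact: first_half_continuous.
  - by rewrite first_half_zero d0 /b/= w0.
  - transitivity (first_half (q \o d)) => //.
    rewrite qd; transitivity (phi \o first_half (path_cat a (path_rev a'))) => //.
    by rewrite first_half_cat; apply/funext => s /=; rewrite qw.
have a'b' : path_rev (second_half d) = b'.
  apply: (rigid_unique_path_lifting rigid_q) => //.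
  - exact/path_rev_continuous/second_half_continuous.
  - by rewrite path_rev_zero second_half_one d1 /b'/= w'0.
  - transitivity (path_rev (second_half (q \o d))) => //.
    rewrite qd.
    transitivity (phi \o path_rev (second_half (path_cat a (path_rev a')))) => //.
    by rewrite second_half_cat// path_revK; apply/funext => s /=; rewrite qw'.
transitivity (b one); first by rewrite /b/= w1.
by rewrite -ab first_half_one -path_rev_one a'b' /b'/= w'1.
Qed.

(** Let [L] lift the homotopy that moves [phi e0] along the images of the paths
    issuing from [e0].  Then [f] at the end of a path [z] is [L (z, one)], which is
    continuous in [z] at the constant path. *)
Lemma transport_continuous (f : E -> F) : locally_path_connected R E ->
  (forall e, transport e (f e)) -> continuous f.
Proof.
move=> lpcE tf e0.
have fE e y : transport e y -> f e = y by exact/transport_fun.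
pose Z := rooted_path R e0.
pose K (u : Z * I) := phi (rooted_eval u.1 u.2).
have cK : continuous K.
  exact: (cts_comp (@rooted_eval_continuous _ _ _) (@ptmap_continuous _ _ phi)).
have [|L [cL L0 qL]] := rigid_q.1.2 Z (fun=> f e0) K (@cts_cst _ _ (f e0)) cK.
  by move=> [c cc c0]; rewrite /K /rooted_eval/= c0 (transport_over (tf e0)).
have fL z : f (rooted_eval z one) = L (z, one).
  apply: fE; apply: (transport_extend (c := rooted_eval z) (d := fun s => L (z, s)) (tf e0)).
  - by case: z.
  - apply: (cts_comp _ cL); apply: cts_pair; first exact: cts_cst.
    by move=> s; exact: cvg_id.
  - by case: z.
  - exact: L0.
  - by apply/funext => s; exact: (congr1 (@^~ (z, s)) qL).
move=> W fW.
have cend : continuous (fun z : Z => L (z, one)).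
  apply: (cts_comp _ cL); apply: cts_pair; last exact: cts_cst.
  by move=> z; exact: cvg_id.
have /(_ W) := cend (rooted_cst R e0).
rewrite /= -fL => /(_ fW)[_ /(_ (fun=> erefl))[U e0U UW]].
have [V [oV Ve0 VU pcV]] := lpcE e0 U e0U.
apply: (filterS _ (open_nbhs_nbhs (conj oV Ve0))) => e Ve /=.
have [c cV] := pcV e0 e Ve0 Ve.
have cc : continuous c by exact: cts_fun.
pose z : Z := exist2 _ _ (c : I -> E) cc (path_zero (s := c)).
have <- : rooted_eval z one = e by exact: path_one.
by rewrite fL; apply: UW => s; exact/VU/cV.
Qed.

Lemma rigid_fibration_lifting :
  path_connected R [set: E] -> locally_path_connected R E ->
  exists f : ptmap E F, q \o f = phi.
Proof.
move=> pcE lpcE.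
have [f tf] := choice (transport_total pcE).
have f0 : f point = point by exact: transport_fun (tf point) transport_point.
exists (PtMap (transport_continuous lpcE tf) f0).
by apply/funext => e; exact: transport_over.
Qed.

End lifting_criterion.

Theorem theorem3p12 (R : realType) (X Y EH EG : ptopologicalType)
    (p : ptmap EH X) (q : ptmap EG Y) (H : set (pi1 R X)) (G : set (pi1 R Y)) :
  rigid_fibration R p -> rigid_fibration R q ->
  subgroup H -> subgroup G ->
  pi1_map R p @` setT = H -> pi1_map R q @` setT = G ->
  [/\
    path_connected R [set: EH] -> locally_path_connected R EH ->
    forall g : ptmap X Y, pi1_map R g @` H `<=` G ->
      exists f : ptmap EH EG, q \o f = g \o p,
    forall g : ptmap X Y, rigid_fibration R g -> pi1_map R g @` H `<=` G ->
      forall f : ptmap EH EG, q \o f = g \o p -> rigid_fibration R f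
  &
    forall g : ptmap X Y, (exists f : ptmap EH EG, q \o f = g \o p) ->
      pi1_map R g @` H `<=` G ].
Proof.
move=> rp rq _ _ <- <-; split.
- move=> pcE lpcE g gHG.
  apply: (rigid_fibration_lifting (phi := ptmap_comp g p) rq) => //.
  move=> _ [u _ <-]; apply: gHG; exists (pi1_map R p u); first by exists u.
  exact: pi1_map_comp.
- move=> g rg _ f qf; apply: (rigid_fibration_factor _ rq).
    exact: ptmap_continuous.
  by rewrite qf; exact: rigid_fibration_comp.
- move=> g [f qf] _ [_ [u _ <-] <-].
  exists (pi1_map R f u) => //.
  transitivity (pi1_map R (ptmap_comp g p) u); first exact: pi1_map_comp.
  by symmetry; exact: pi1_map_comp.
Qed.
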